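(* Let $A$ be a Banach algebra and let $E\subseteq A^*\setminus\Delta(A)$. Then $C_{\mathrm{BSE}}(\Delta(A),E)$ is equal to the set of all $\sigma\in C_b(\Delta(A)\cup E)$ for which there exists a bounded net $\{x_\alpha\}$ in $A$ with $\lim_\alpha f(x_\alpha)=\sigma(f)$ for all $f\in\Delta(A)\cup E$.
   Context: Algebras are over $\mathbb{C}$. $\Delta(A)$ is the set of all non-zero (algebra) homomorphisms $A\to\mathbb{C}$, viewed as a subset of the dual space $A^*$. The set $\Delta(A)\cup E\subseteq A^*$ carries the relative weak$^*$ topology, and $C_b(\Delta(A)\cup E)$ denotes the bounded continuous complex-valued functions on it. A function $\sigma\in C_b(\Delta(A)\cup E)$ is called a BSE-like function if there exists $M>0$ such that for all $f_1,\dots,f_n\in\Delta(A)\cup E$ and all complex numbers $c_1,\dots,c_n$, $$\left|\sum_{i=1}^n c_i\sigma(f_i)\right|\le M\left\|\sum_{i=1}^n c_if_i\right\|_{A^*}.$$ $C_{\mathrm{BSE}}(\Delta(A),E)$ denotes the set of all BSE-like functions on $\Delta(A)\cup E$. A net in $A$ is bounded if the norms of its members are bounded by a common finite constant. *)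

(* Defs.v *)
From HB Require Import structures.
From mathcomp Require Import all_boot all_order all_algebra.
From mathcomp Require Import complex.
From mathcomp Require Import all_classical all_reals all_analysis.
Set Implicit Arguments.
Unset Strict Implicit.
Unset Printing Implicit Defensive.
Import Order.TTheory GRing.Theory Num.Theory.
Import numFieldNormedType.Exports.
Local Open Scope classical_set_scope.
Local Open Scope ring_scope.
Local Open Scope complex_scope.

(* Neither a unit nor commutativity is assumed, which is why the product is not
   a MathComp ring multiplication. *)
HB.mixin Record isBanachAlgebra (K : numFieldType) A
    of CompleteNormedModule K A := {
  bmul : A -> A -> A;
  bmulA : associative bmul;
  bmulDl : left_distributive bmul +%R;
  bmulDr : right_distributive bmul +%R;
  bmulZl : forall (c : K) (x y : A), bmul (c *: x) y = c *: bmul x y;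
  bmulZr : forall (c : K) (x y : A), bmul x (c *: y) = c *: bmul x y;
  bmul_norm : forall x y : A, `|bmul x y| <= `|x| * `|y|
}.

#[short(type="banachAlgType")]
HB.structure Definition BanachAlgebra (K : numFieldType) :=
  {A of CompleteNormedModule K A & isBanachAlgebra K A}.

(* On [R[i]] itself no topology is declared; [R[i]^o] carries the one of the
   modulus. *)
Notation Cplx R := (R[i]^o) (only parsing).

Section Dual.
Context {R : realType} (A : banachAlgType R[i]).

Definition dual : set (A -> Cplx R) :=
  [set f : A -> Cplx R | linear f /\ continuous f].

(* The norm of [A] takes its values in [R[i]], hence [complex.Re]. *)
Definition dual_norm (f : A -> Cplx R) : R :=
  sup [set complex.Re `|f x| | x in [set x : A | `|x| <= 1]].

(* Continuity is automatic; see [Delta_sub_dual]. *)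
Definition Delta : set (A -> Cplx R) :=
  [set f : A -> Cplx R | [/\ linear f, forall x y, f (bmul x y) = f x * f y
             & exists x, f x != 0]].

(* [{ptws A -> _}] is the topology of pointwise convergence on [A -> _], which
   induces the weak* topology on the dual and on its subsets; as a type, a set
   in it carries the relative topology. *)
Definition DeltaU (E : set (A -> Cplx R)) : set {ptws A -> Cplx R} :=
  Delta `|` E.

End Dual.
Arguments dual {R} A _.
Arguments Delta {R} A _.

Section AutomaticContinuity.
Context {R : realType} (A : banachAlgType R[i]).

Lemma quasi_inverse (a : A) : `|a| < 1 -> exists b, b = a + bmul a b.
Proof.
move=> a1. pose q := complex.Re `|a|.
have qE : `|a| = q%:C by rewrite RRe_real ?normr_real.
have q0 : 0 <= q by rewrite -lecR -qE; exact: normr_ge0.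
have q1 : q < 1 by rewrite -ltcR -qE.
pose u (k : nat) := iter k (bmul a) a.
have uq k : `|u k| <= (q ^+ k.+1)%:C.
  elim: k => [|k IHk]; first by rewrite expr1 qE.
  rewrite exprS rmorphM /= -qE (le_trans (bmul_norm _ _))//.
  exact: ler_wpM2l.
have sumq m n : \sum_(m <= k < n) q ^+ k.+1 <= q ^+ m / (1 - q).
  have [nm|/ltnW mn] := leqP n m.
    by rewrite big_geq// divr_ge0 ?exprn_ge0// subr_ge0 ltW.
  rewrite ler_pdivlMr ?subr_gt0// mulr_suml.
  under eq_bigr do rewrite mulrBr mulr1 -exprSr -opprB.
  rewrite sumrN (telescope_sumr (fun k => q ^+ k.+1))// opprB.
  by rewrite lerBlDr -[leLHS]addr0 lerD ?exprn_ge0// ler_wiXn2l// ltW.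
have /cauchy_seriesP/cauchy_cvgP cu : forall e : R[i], 0 < e ->
    \forall n \near (\oo, \oo), `|\sum_(n.1 <= k < n.2) u k| < e.
  move=> e e0.
  have eE : e = (complex.Re e)%:C by rewrite RRe_real// gtr0_real.
  have r0 : 0 < complex.Re e by rewrite -ltcR -eE.
  have r1 : 0 < complex.Re e * (1 - q) by rewrite mulr_gt0// subr_gt0.
  have qn : q ^+ n @[n --> \oo] --> (0 : R).
    by apply: cvg_expr; rewrite ger0_norm.
  have /cvgrPdist_lt/(_ _ r1) [N _ HN] := qn.
  exists ([set n | (N <= n)%N], setT).
    by split; [exists N | exact: filterT].
  move=> [m n] [/= Nm _]; rewrite (le_lt_trans (ler_norm_sum _ _ _))//.
  apply: (@le_lt_trans _ _ (\sum_(m <= k < n) q ^+ k.+1)%:C).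
    by rewrite rmorph_sum; apply: ler_sum => k _; exact: uq.
  rewrite eE ltcR (le_lt_trans (sumq _ _))// ltr_pdivrMr ?subr_gt0//.
  by have := HN _ Nm; rewrite /= sub0r normrN ger0_norm// exprn_ge0.
pose b := lim (series u @ \oo).
have cb : series u @ \oo --> b by exact: cu.
have sE n : series u n.+1 = a + bmul a (series u n).
  rewrite /series /= big_nat_recl//; congr (_ + _).
  elim: n => [|n IHn].
    by rewrite !big_geq// -(scale0r (0 : A)) bmulZr !scale0r.
  by rewrite !big_nat_recr//= IHn bmulDr.
exists b.
have c1 : series u n.+1 @[n --> \oo] --> b by rewrite (cvg_shiftS (series u)).
have c2 : series u n.+1 @[n --> \oo] --> a + bmul a b.
  apply/cvgrPdist_lt => e e0; move/cvgrPdist_lt: cb => /(_ _ e0).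
  apply: filterS => n; apply: le_lt_trans.
  have -> : a + bmul a b - series u n.+1 = bmul a (b - series u n).
    rewrite sE opprD addrACA subrr add0r bmulDr; congr (_ + _).
    by rewrite -scaleN1r -bmulZr scaleN1r.
  rewrite (le_trans (bmul_norm _ _))// -[leRHS]mul1r.
  by rewrite ler_wpM2r// ltW.
exact: (cvg_unique _ c1 c2).
Qed.

Lemma Delta_norm (f : A -> Cplx R) : Delta A f -> forall a, `|f a| <= `|a|.
Proof.
move=> [lf mf _] a; rewrite real_leNgt ?normr_real//; apply/negP => fa.
have fa0 : f a != 0 by rewrite -normr_gt0 (le_lt_trans _ fa).
have f0 : f 0 = 0 by have := lf (-1) 0 0; rewrite scaler0 addr0 scaleN1r addNr.
have fZ k x : f (k *: x) = k * f x by rewrite -[k *: x]addr0 lf f0 addr0.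
have fD x y : f (x + y) = f x + f y by rewrite -[x]scale1r lf !scale1r.
pose a' := (f a)^-1 *: a.
have fa' : f a' = 1 by rewrite fZ mulVf.
have /quasi_inverse[b /(congr1 f)] : `|a'| < 1.
  by rewrite normrZ normfV ltr_pdivrMl ?normr_gt0// mulr1.
rewrite fD mf fa' mul1r => /eqP.
by rewrite -subr_eq subrr eq_sym oner_eq0.
Qed.

Lemma Delta_sub_dual : Delta A `<=` dual A.
Proof.
move=> f Df; have [lf _ _] := Df; split=> //.
pose g : {linear A -> Cplx R} := HB.pack f (GRing.isLinear.Build _ _ _ _ _ lf).
apply: (@bounded_linear_continuous _ _ _ g); apply/linear_boundedP.
near=> r => x; apply: le_trans (Delta_norm Df x) _.
by rewrite ler_peMl//; near: r; exact: nbhs_pinfty_ge.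
Unshelve. all: by end_near. Qed.

End AutomaticContinuity.

Definition Cb {R : realType} (T : topologicalType) : set (T -> Cplx R) :=
  [set s | continuous s /\ [bounded s t | t in [set: T]]].

Definition BSE_like {R : realType} {A : banachAlgType R[i]}
    (E : set (A -> Cplx R)) (s : DeltaU E -> Cplx R) : Prop :=
  exists2 M : R, 0 < M &
    forall (n : nat) (f : 'I_n -> DeltaU E) (c : 'I_n -> R[i]),
      `|\sum_(i < n) c i * s (f i)| <=
      (M * dual_norm (\sum_(i < n) c i *: (set_val (f i) : A -> Cplx R)))%:C.

Definition C_BSE {R : realType} {A : banachAlgType R[i]}
    (E : set (A -> Cplx R)) : set (DeltaU E -> Cplx R) :=
  [set s | Cb s /\ BSE_like s].
Arguments C_BSE {R A} E _.

Definition directed {I : Type} (le : I -> I -> Prop) : Prop :=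
  [/\ inhabited I, forall i, le i i,
      forall i j k, le i j -> le j k -> le i k
    & forall i j, exists2 k, le i k & le j k].

Record directedSet := DirectedSet {
  ds_sort :> Type;
  ds_le : ds_sort -> ds_sort -> Prop;
  ds_directed : directed ds_le
}.

(* The filter of eventually true predicates: [x i @[i --> tails I] --> l] says
   that the net [x] converges to [l]. *)
Definition tails (I : directedSet) : set_system I :=
  [set P | exists i0, forall i, ds_le i0 i -> P i].
Arguments tails I _ : clear implicits.

#[export] Instance tails_proper (I : directedSet) : ProperFilter (tails I).
Proof.
have [[i1] refl trans ub] := ds_directed I.
split; first by case=> i /(_ i (refl i)).
split=> [|P Q [i Pi] [j Qj]|P Q PQ [i Pi]].
- by exists i1.
- have [k ik jk] := ub i j; exists k => l kl.
  by split; [apply: Pi; apply: trans kl | apply: Qj; apply: trans kl].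
- by exists i => j /Pi /PQ.
Qed.

Definition bounded_net {R : realType} {A : banachAlgType R[i]}
    {I : directedSet} (x : I -> A) : Prop :=
  exists M : R, forall i, `|x i| <= M%:C.

(* Main.v *)
(* A BSE-like [s] is, on finitely many functionals [f_1, ..., f_n], approximable
   by the values at a point of the ball of radius [M] (an approximate form of
   Helly's theorem): otherwise some linear form strictly separates
   [(s f_1, ..., s f_n)] from the convex image of that ball in [C^n], and its
   coefficients violate the BSE inequality. Choosing such points for all finite
   sets of functionals and all precisions [1 / (k + 1)] gives the net.
   Conversely, the BSE inequality holds along a bounded net and passes to the
   limit. *)
Require Import Defs.
From HB Require Import structures.
From mathcomp Require Import all_boot all_order all_algebra.
From mathcomp Require Import complex.
From mathcomp Require Import all_classical all_reals all_analysis.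
From mathcomp Require Import ring lra.
Set Implicit Arguments.
Unset Strict Implicit.
Unset Printing Implicit Defensive.
Import Order.TTheory GRing.Theory Num.Theory.
Import numFieldNormedType.Exports.
Local Open Scope classical_set_scope.
Local Open Scope ring_scope.
Local Open Scope complex_scope.

(* No compactness is needed: at a point [y0] of [C] that minimizes the distance
   to [a] only approximately, [w := a - y0] already separates, as one sees by
   moving from [y0] towards [y] by the small step [t]. *)
Lemma convex_approx_or_separate (R : realType) (J : finType)
    (C : set (J -> R)) (a : J -> R) (K e : R) :
  C !=set0 ->
  (forall y z t, C y -> C z -> 0 <= t <= 1 ->
     C (fun j => y j + t * (z j - y j))) ->
  (forall y z, C y -> C z -> \sum_j (z j - y j) ^+ 2 <= K) ->
  0 < e ->
  (exists2 y, C y & \sum_j (a j - y j) ^+ 2 < e) \/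
  (exists (w : J -> R) (delta : R), 0 < delta /\
     forall y, C y -> \sum_j w j * y j + delta <= \sum_j w j * a j).
Proof.
move=> [z0 Cz0] convC bndC e0.
have [|far] := pselect (exists2 y, C y & \sum_j (a j - y j) ^+ 2 < e).
  by left.
right.
pose D := [set \sum_j (a j - y j) ^+ 2 | y in C].
have Dlb : lbound D e.
  by move=> _ [y Cy <-]; rewrite leNgt; apply/negP => ye; apply: far; exists y.
have D0 : D !=set0 by exists (\sum_j (a j - z0 j) ^+ 2); exists z0.
pose d := inf D.
have d0 : 0 < d by apply: lt_le_trans e0 _; exact: lb_le_inf.
have Dinf : has_inf D by split=> //; exists e.
have K0 : 0 <= K.
  by apply: le_trans (bndC _ _ Cz0 Cz0); apply: sumr_ge0 => j _; exact: sqr_ge0.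
(* This choice gives [t * K <= d / 2]. As [Q] exceeds [d] by less than [t * d], dividing the
   quadratic estimate by [t] yields [2 * P <= 3 * d / 2], whence [Q - P >= d / 4], the margin used
   below. *)
pose t := d / (2 * K + d).
have den0 : 0 < 2 * K + d by lra.
have t0 : 0 < t by rewrite divr_gt0.
have t1 : t <= 1 by rewrite ler_pdivrMr ?mul1r//; lra.
have tK : t * (2 * K + d) = d by rewrite divfK ?gt_eqF.
have [_ [y0 Cy0 <-] y0d] := inf_adherent (mulr_gt0 t0 d0) Dinf.
rewrite -/d in y0d.
pose w j := a j - y0 j.
exists w, (d / 4); split; first by lra.
move=> y Cy.
pose Q := \sum_j w j ^+ 2; pose P := \sum_j w j * (y j - y0 j).
have dQ : d <= Q by apply: ge_inf; [case: Dinf | exists y0].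
have step : d <= Q - 2 * t * P + t ^+ 2 * \sum_j (y j - y0 j) ^+ 2.
  apply: ge_inf; first by case: Dinf.
  exists (fun j => y0 j + t * (y j - y0 j)); first by apply: convC => //; rewrite ltW.
  rewrite /Q /P !mulr_sumr -sumrB -big_split/=; apply: eq_bigr => j _.
  by rewrite /w; ring.
have sE : \sum_j w j * a j - \sum_j w j * y j = Q - P.
  by rewrite /Q /P -!sumrB; apply: eq_bigr => j _; rewrite /w; ring.
have yK := bndC _ _ Cy0 Cy.
have QE : Q < d + t * d by [].
have {}step : 2 * t * P <= t * (d + t * K).
  have : t ^+ 2 * \sum_j (y j - y0 j) ^+ 2 <= t ^+ 2 * K.
    by rewrite ler_wpM2l// sqr_ge0.
  by move: step QE; lra.
have : 2 * P <= d + t * K by rewrite -(ler_pM2l t0); lra.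
have tKd : t * K <= d / 2 by have := mulr_gt0 t0 d0; lra.
lra.
Qed.

(** * Norms with values in [R[i]] compared with real bounds *)

Lemma lecR_norm (R : realType) (V : normedZmodType R[i]) (z : V) (r : R) :
  (`|z| <= r%:C) = (complex.Re `|z| <= r).
Proof. by rewrite -[in LHS](RRe_real (normr_real z)) lecR. Qed.

Lemma ltcR_norm (R : realType) (V : normedZmodType R[i]) (z : V) (r : R) :
  (`|z| < r%:C) = (complex.Re `|z| < r).
Proof. by rewrite -[in LHS](RRe_real (normr_real z)) ltcR. Qed.

Lemma Re_norm_ge0 (R : realType) (V : normedZmodType R[i]) (z : V) :
  0 <= complex.Re `|z|.
Proof. by rewrite -lecR RRe_real ?normr_ge0 ?normr_real. Qed.

(** * Functionals in the dual and their operator norm *)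

Section Functionals.
Context {R : realType} (A : banachAlgType R[i]).

Lemma functionalZ (f : A -> Cplx R) k x : linear f -> f (k *: x) = k * f x.
Proof.
move=> lf; pose g : {linear A -> Cplx R} :=
  HB.pack f (GRing.isLinear.Build _ _ _ _ _ lf).
exact: (linearZ_LR g).
Qed.

Lemma functionalD (f : A -> Cplx R) x y : linear f -> f (x + y) = f x + f y.
Proof. by move=> lf; rewrite -[x]scale1r lf !scale1r. Qed.

Lemma dual_bounded (f : A -> Cplx R) : dual A f ->
  exists2 B : R, 0 <= B & forall x, `|f x| <= B%:C * `|x|.
Proof.
move=> [lf cf].
pose g : {linear A -> Cplx R} := HB.pack f (GRing.isLinear.Build _ _ _ _ _ lf).
have /linear_bounded_continuous/linear_boundedP [M [Mr MB]] : continuous g by [].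
(* The bound holds for every real above [M], hence the [+ 1]; the absolute value ensures
   [0 <= B]. *)
exists (`|complex.Re M| + 1); first by rewrite addr_ge0.
apply: MB; rewrite -[M]RRe_real// ltcR.
have := ler_norm (complex.Re M); lra.
Qed.

(** Since [sup] takes a default value on unbounded sets, this is what makes [dual_norm] a true
    supremum on [dual A]. *)
Lemma dual_norm_has_ubound (f : A -> Cplx R) : dual A f ->
  has_ubound [set complex.Re `|f x| | x in [set x : A | `|x| <= 1]].
Proof.
move=> /dual_bounded[B B0 fB]; exists B => _ [u u1 <-]; rewrite -lecR_norm.
by rewrite (le_trans (fB u))// -[leRHS]mulr1 ler_wpM2l// lecR.
Qed.

Lemma dual_norm_ge0 (f : A -> Cplx R) : dual A f -> 0 <= dual_norm f.
Proof.
move=> df; apply: (le_trans (Re_norm_ge0 (f 0))).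
by apply: ub_le_sup (dual_norm_has_ubound df) _ _; exists 0 => //=; rewrite normr0.
Qed.

Lemma dual_norm_bound (f : A -> Cplx R) : dual A f ->
  forall x, `|f x| <= (dual_norm f)%:C * `|x|.
Proof.
move=> df x; have [lf _] := df.
have [->|x0] := eqVneq x 0.
  by rewrite -(scale0r 0) functionalZ// scale0r mul0r !normr0 mulr0.
have nx0 : `|x| != 0 by rewrite normr_eq0.
have -> : f x = `|x| * f (`|x|^-1 *: x).
  by rewrite functionalZ// mulrA divff// mul1r.
rewrite normrM normr_id mulrC ler_wpM2r// lecR_norm.
apply: ub_le_sup (dual_norm_has_ubound df) _ _.
by exists (`|x|^-1 *: x) => //=; rewrite normrZ normfV normr_id mulVf.
Qed.

Lemma dual_sum n (f : 'I_n -> A -> Cplx R) (c : 'I_n -> R[i]) :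
  (forall i, dual A (f i)) -> dual A (\sum_(i < n) c i *: f i).
Proof.
move=> df; split.
  move=> k x y; rewrite !fct_sumE scaler_sumr -big_split; apply: eq_bigr => i _ /=.
  have [lf _] := df i; have E z : (c i *: f i) z = c i * f i z by [].
  by rewrite !E functionalD// functionalZ// mulrDr mulrCA.
move=> x; rewrite fct_sumE; apply: cvg_big => [|i _]; first exact: add_continuous.
by apply: cvgZl_tmp; have [_] := df i; apply.
Qed.

(** Separation takes place over the reals, in dimension [2n]: index [(true, i)] carries the real
    part and [(false, i)] the imaginary part of the [i]-th value. A separating vector is turned back
    into a complex combination [g] whose norm is too small for the BSE inequality. *)
Lemma helly_approx n (f : 'I_n -> A -> Cplx R) (s : 'I_n -> R[i]) (M : R) :
  0 < M -> (forall i, dual A (f i)) ->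
  (forall c : 'I_n -> R[i], `|\sum_(i < n) c i * s i| <=
     (M * dual_norm (\sum_(i < n) c i *: f i))%:C) ->
  forall e : R, 0 < e ->
  exists2 x, `|x| <= M%:C & forall i, `|f i x - s i| < e%:C.
Proof.
move=> M0 df sM e e0.
pose part (b : bool) (z : R[i]) := if b then complex.Re z else complex.Im z.
have partB b (x y : R[i]) : part b (x - y) = part b x - part b y.
  by case: b x y => -[? ?] [? ?].
have partZ b (r : R) (y : R[i]) : part b (r%:C * y) = r * part b y.
  by case: b y => -[? ?] /=; rewrite !(mul0r, subr0, addr0).
have partD b (x y : R[i]) : part b (x + y) = part b x + part b y.
  by case: b x y => -[? ?] [? ?].
have sumJ (F : bool * 'I_n -> R) :
    \sum_j F j = \sum_(i < n) (F (true, i) + F (false, i)).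
  rewrite (eq_bigr (fun j => F (j.1, j.2))) => [|[]//].
  rewrite -(pair_bigA _ (fun b i => F (b, i)))/= exchange_big/=.
  by apply: eq_bigr => i _; rewrite big_bool.
have normE (z : R[i]) :
    part true z ^+ 2 + part false z ^+ 2 = complex.Re `|z| ^+ 2.
  by rewrite normc_def/= sqr_sqrtr// addr_ge0 ?sqr_ge0.
pose C := [set y : bool * 'I_n -> R |
  exists2 x : A, `|x| <= M%:C & y = fun j => part j.1 (f j.2 x)].
have convC y z t : C y -> C z -> 0 <= t <= 1 ->
    C (fun j => y j + t * (z j - y j)).
  move=> [u uM ->] [v vM ->] /andP[t0 t1].
  exists (u + t%:C *: (v - u)).
    have -> : u + t%:C *: (v - u) = (1 - t)%:C *: u + t%:C *: v.
      by rewrite rmorphB/= scalerBr scalerBl scale1r addrA addrAC.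
    rewrite (le_trans (ler_normD _ _))// !normrZ !ger0_norm ?lecR ?subr_ge0//.
    have -> : M%:C = (1 - t)%:C * M%:C + t%:C * M%:C :> R[i].
      by rewrite -mulrDl -rmorphD/= subrK mul1r.
    by rewrite lerD// ler_wpM2l// lecR ?subr_ge0.
  apply/funext => -[b i] /=; have [lf _] := df i.
  have fB : f i (v - u) = f i v - f i u.
    by rewrite functionalD// -(scaleN1r u) functionalZ// mulN1r.
  by rewrite functionalD// functionalZ// fB partD partZ partB.
have /choice[B fB] : forall i, exists b : R,
    0 <= b /\ forall x, `|f i x| <= b%:C * `|x|.
  by move=> i; have [b b0 fb] := dual_bounded (df i); exists b.
(* Both values of [f i] have modulus at most [B i * M], so they differ by at most twice that. *)
have bndC y z : C y -> C z ->
    \sum_j (z j - y j) ^+ 2 <= \sum_(i < n) (2 * (B i * M)) ^+ 2.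
  move=> [u uM ->] [v vM ->]; rewrite sumJ; apply: ler_sum => i _ /=.
  have [B0 fBi] := fB i.
  have fM x : `|x| <= M%:C -> `|f i x| <= (B i * M)%:C.
    move=> xM; apply: (le_trans (fBi x)); rewrite rmorphM/=.
    by rewrite ler_wpM2l// lecR.
  rewrite -!(partB true) -!(partB false) normE ler_pXn2r ?nnegrE//.
  - rewrite -lecR_norm// (le_trans (ler_normB _ _))//.
    by rewrite mulr_natl rmorphMn mulr2n lerD ?fM.
  - exact: Re_norm_ge0.
  - by rewrite mulr_ge0// mulr_ge0// ltW.
have C0 : C !=set0.
  by eexists; exists 0 => //; rewrite normr0 lecR ltW.
(* The precision is [e ^+ 2] because squared distances are measured; the two coordinates of one [i]
   contribute at most the whole sum. *)
have [[_ [x xM ->] xs]|[w [delta [delta0 sep]]]] :=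
  convex_approx_or_separate (fun j => part j.1 (s j.2)) C0 convC bndC
    (exprn_gt0 2 e0).
  exists x => // i; rewrite ltcR_norm.
  rewrite -(ltr_pXn2r (ltn0Sn 1)) ?nnegrE ?Re_norm_ge0 ?(ltW e0)//.
  rewrite distrC -normE !partB; apply: le_lt_trans xs.
  rewrite sumJ (bigD1 i)//= lerDl; apply: sumr_ge0 => j _.
  by rewrite addr_ge0 ?sqr_ge0.
(* The conjugate makes the real part of [c i * z] equal to
   [w (true, i) * Re z + w (false, i) * Im z]. *)
pose c i : R[i] := w (true, i) -i* w (false, i).
have ReE (v : 'I_n -> R[i]) :
    complex.Re (\sum_(i < n) c i * v i) = \sum_j w j * part j.1 (v j.2).
  rewrite sumJ; apply: (big_ind2 (fun (z : R[i]) r => complex.Re z = r)) => //.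
    by move=> [? ?] _ [? ?] _ <- <-.
  by move=> i _; rewrite /c; case: (v i) => p q /=; rewrite mulNr opprK.
pose g := \sum_(i < n) c i *: f i.
have gE x : g x = \sum_(i < n) c i * f i x by rewrite /g fct_sumE.
have dg : dual A g by exact: dual_sum.
have [lg _] := dg.
pose T := complex.Re (\sum_(i < n) c i * s i).
have gT x : `|x| <= M%:C -> complex.Re (g x) + delta <= T.
  by move=> xM; rewrite gE /T !ReE; apply: sep; exists x.
(* This contradicts [sM], which gives [T <= M * dual_norm g]. *)
have : dual_norm g <= (T - delta) / M.
  apply: ge_sup.
    by exists (complex.Re `|g 0|); exists 0 => //=; rewrite normr0.
  move=> _ [u u1 <-]; rewrite ler_pdivlMr// lerBrDr.
  (* The phase [v] turns [g u] into its modulus, as [gT] controls only real parts. If [g u = 0],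
     then [v = 0] by the convention on division, so [v1] is only an inequality. *)
  pose v := `|g u| / g u.
  have vg : v * g u = `|g u|.
    by rewrite /v; have [->|?] := eqVneq (g u) 0; rewrite ?normr0 ?mulr0// divfK.
  have v1 : `|v| <= 1.
    rewrite /v normrM normr_id normfV; have [->|?] := eqVneq (g u) 0.
      by rewrite normr0 mul0r.
    by rewrite divff// normr_eq0.
  have -> : complex.Re `|g u| * M = complex.Re (g ((M%:C * v) *: u)).
    rewrite (functionalZ _ _ lg) -(mulrA M%:C v (g u)) vg.
    by rewrite -(RRe_real (normr_real (g u)))/= mul0r subr0 mulrC.
  apply: gT; rewrite normrZ normrM ger0_norm ?lecR ?(ltW M0)//.
  rewrite -[leRHS]mulr1 -mulrA ler_wpM2l// ?lecR ?(ltW M0)//.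
  by rewrite mulr_ile1.
rewrite ler_pdivlMr// mulrC.
have : `|T|%:C <= (M * dual_norm g)%:C := le_trans (normc_ge_Re _) (sM c).
by rewrite lecR; have := ler_norm T; lra.
Qed.

End Functionals.

Theorem theorem4p2 (R : realType) (A : banachAlgType R[i])
    (E : set (A -> Cplx R)) (hE : E `<=` dual A `\` Delta A) :
  C_BSE E =
  [set s : DeltaU E -> Cplx R | Cb s /\
    exists (I : directedSet) (x : I -> A), bounded_net x /\
      forall f : DeltaU E,
        (set_val f (x i) : Cplx R) @[i --> tails I] --> s f].
Proof.
have dualE (f : DeltaU E) : dual A (set_val f).
  by have [/Delta_sub_dual|/hE[]] := set_valP f.
apply/seteqP; split => s [cs].
- case=> M M0 sM; split=> //.
  (* Lists stand for finite sets and are compared by membership, so [le] is only a preorder, as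
     [directed] allows. *)
  pose le (p q : seq (DeltaU E) * nat) := {subset p.1 <= q.1} /\ (p.2 <= q.2)%N.
  have dirle : directed le.
    split; first by constructor; exact: ([::], 0%N).
    - by move=> p; split.
    - move=> p q r [pq1 pq2] [qr1 qr2]; split; last exact: leq_trans qr2.
      by move=> f /pq1/qr1.
    - move=> p q; exists (p.1 ++ q.1, maxn p.2 q.2); split=> /=.
      + by move=> f fp; rewrite mem_cat fp.
      + exact: leq_maxl.
      + by move=> f fq; rewrite mem_cat fq orbT.
      + exact: leq_maxr.
  have /choice[x xP] : forall p : seq (DeltaU E) * nat, exists x : A,
      `|x| <= M%:C /\
      forall f, f \in p.1 -> `|set_val f x - s f| < (p.2.+1%:R^-1)%:C.
    move=> [F k] /=.
    have := @helly_approx _ _ _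
      (fun i : 'I_(size F) => set_val (tnth (in_tuple F) i))
      (fun i => s (tnth (in_tuple F) i)) M M0.
    have k0 : 0 < (k.+1%:R^-1 : R) by rewrite invr_gt0.
    move=> /(_ _ _ _ k0)[||x xM xs].
    + by move=> i; exact: dualE.
    + by move=> c; exact: sM.
    + exists x; split=> // f /(tnthP (in_tuple F))[i ->]; exact: xs.
  exists (DirectedSet dirle), x; split.
    by exists M => p; have [] := xP p.
  move=> f; apply/cvgrPdist_lt => e e0.
  have eE : e = (complex.Re e)%:C by rewrite RRe_real// gtr0_real.
  have r0 : 0 < complex.Re e by rewrite -ltcR -eE.
  have [k _ kP] := near_infty_natSinv_lt (PosNum r0).
  (* Beyond this index the list contains [f] and the precision is below [e]. *)
  exists ([:: f], k) => -[F m] [/= Ff km]; have [_ /(_ f)] := xP (F, m).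
  rewrite distrC => /(_ (Ff _ (mem_head _ _)))/lt_trans; apply.
  by rewrite eE ltcR; exact: kP.
- case=> I [x [[M xM] xs]]; split=> //.
  (* A BSE constant must be positive, while [M] may be zero. *)
  exists (`|M| + 1); first by rewrite ltr_wpDl.
  (* Up to an error [e], the inequality is read off at a single late index [j] of the net. *)
  move=> n f c; apply/ler_addgt0Pr => e e0.
  set g := (\sum_(i < n) c i *: (set_val (f i) : A -> Cplx R)).
  have dg : dual A g by apply: dual_sum => i; exact: dualE.
  have gx : g (x j) @[j --> tails I] --> (\sum_(i < n) c i * s (f i) : Cplx R).
    rewrite /g fct_sumE; apply: cvg_big => [|i _]; first exact: add_continuous.
    exact: cvgZl_tmp.
  move/cvgrPdist_lt: gx => /(_ _ e0)/filter_ex[j /ltW je].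
  rewrite -[X in `|X|](subrK (g (x j))) addrC (le_trans (ler_normD _ _))// lerD//.
  apply: (le_trans (dual_norm_bound dg (x j))).
  rewrite mulrC rmorphM/= ler_wpM2r ?lecR ?dual_norm_ge0//.
  apply: (le_trans (xM j)); rewrite lecR; have := ler_norm M; lra.
Qed.
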